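(* There exists an infinitely distributive lattice $L$ which is a regular sublattice of the Dedekind complete vector lattice $\mathbb R^3$ (with the coordinatewise order), while $\operatorname{DM}(L)$ is not modular. In particular, $\operatorname{DM}(L)$ is not distributive and admits no lattice embedding into $\mathbb R^3$.
   Context: A lattice $L$ is infinitely distributive if whenever $\bigvee A$ exists, $x\wedge\bigvee A=\bigvee_{a\in A}(x\wedge a)$ for every $x\in L$, and whenever $\bigwedge A$ exists, $x\vee\bigwedge A=\bigwedge_{a\in A}(x\vee a)$ for every $x\in L$. A sublattice $Y$ of a lattice $X$ is regular in $X$ if every supremum or infimum of a nonempty subset of $Y$ that exists in $Y$ also exists in $X$, with the same value. For $A\subseteq L$, $A^+$ and $A^-$ denote the sets of upper and lower bounds of $A$ in $L$. The Dedekind–MacNeille completion $\operatorname{DM}(L)$ is the complete lattice of all $C\subseteq L$ with $C=C^{+-}$, ordered by inclusion. A lattice is modular if $p\le q$ implies $(x\vee p)\wedge q=(x\wedge q)\vee p$ for all $x$. A lattice embedding is an injective map preserving binary joins and meets. *)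

(* Defs.v *)
From HB Require Import structures.
From mathcomp Require Import all_boot all_order all_algebra.
From mathcomp Require Import boolp classical_sets reals.
Set Implicit Arguments.
Unset Strict Implicit.
Unset Printing Implicit Defensive.
Import Order.TTheory.
Local Open Scope classical_set_scope.
Local Open Scope order_scope.

(* [supremums A s] says that the supremum of A exists and equals s; the empty
   family is harmless here since the corresponding identities hold anyway. *)
Definition infinitely_distributive d (L : latticeType d) :=
  (forall (A : set L) (s x : L), supremums A s ->
     supremums [set x `&` a | a in A] (x `&` s)) /\
  (forall (A : set L) (s x : L), infimums A s ->
     infimums [set x `|` a | a in A] (x `|` s)).

Definition modular d (L : latticeType d) :=
  forall p q x : L, p <= q -> (x `|` p) `&` q = (x `&` q) `|` p.

Definition distributive d (L : latticeType d) :=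
  forall x y z : L, x `&` (y `|` z) = (x `&` y) `|` (x `&` z).

(* [subLattice S d'] is an X-sublattice with carrier S: \val preserves meets and
   joins, so lattice operations and order on Y are those of X. *)
Definition regular_sublattice d d' (X : latticeType d) (S : pred X)
    (Y : subLattice S d') :=
  forall (A : set Y) (s : Y), A !=set0 ->
    (supremums A s -> supremums [set \val a | a in A] (\val s)) /\
    (infimums A s -> infimums [set \val a | a in A] (\val s)).

Definition lattice_embedding d d' (X : latticeType d) (Y : latticeType d')
    (f : X -> Y) :=
  [/\ injective f, Order.meet_morphism f & Order.join_morphism f].

Section DedekindMacNeille.
Context d (L : porderType d).
Implicit Types A B C : set L.

(* A^{+-}: the lower bounds of the upper bounds of A. *)
Definition DM_closure A : set L := lbound (ubound A).

Lemma sub_DM_closure A : A `<=` DM_closure A.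
Proof. by move=> x Ax y; apply. Qed.

Lemma DM_closureS A B : A `<=` B -> DM_closure A `<=` DM_closure B.
Proof. by move=> AB x Ax y By; apply: Ax => z /AB; apply: By. Qed.

Lemma DM_closure_id A : DM_closure (DM_closure A) = DM_closure A.
Proof.
apply/seteqP; split; last exact: sub_DM_closure.
by move=> x Ax y Ay; apply: Ax => z; apply.
Qed.

(* Boolean closure condition so that DM is a subType of [set L]; it inherits
   the inclusion order from the canonical order on [set L]. *)
Record DM := MkDM {
  DM_set :> set L;
  DM_setP : `[< DM_set = DM_closure DM_set >]
}.

HB.instance Definition _ := [isSub for DM_set].
HB.instance Definition _ := [Choice of DM by <:].
HB.instance Definition _ := Order.SubChoice_isSubPOrder.Build _ (set L)
  (fun C => `[< C = DM_closure C >]) d DM.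

Lemma DM_leE (C D : DM) : (C <= D) = (DM_set C `<=` DM_set D) :> Prop.
Proof. by rewrite -subsetEset -Order.le_val. Qed.

Lemma DM_setK (C : DM) : DM_closure C = C.
Proof. exact/esym/asboolP/DM_setP. Qed.

Fact DM_meet_closed (C D : DM) :
  `[< setI C D = DM_closure (setI C D) >].
Proof.
apply/asboolP/seteqP; split; first exact: sub_DM_closure.
by move=> x Ex; split; rewrite -DM_setK; apply: DM_closureS Ex => y [].
Qed.

Fact DM_join_closed (C D : DM) :
  `[< DM_closure (setU C D) = DM_closure (DM_closure (setU C D)) >].
Proof. by apply/asboolP; rewrite DM_closure_id. Qed.

Definition DM_meet (C D : DM) : DM := MkDM (DM_meet_closed C D).
Definition DM_join (C D : DM) : DM := MkDM (DM_join_closed C D).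

Fact DM_meetP (C D E : DM) : (C <= DM_meet D E) = (C <= D) && (C <= E).
Proof.
apply/idP/andP; rewrite !DM_leE /=; [move=> h|move=> [h k] x Cx].
  by split=> x /h [].
by split; [exact: h|exact: k].
Qed.

Fact DM_joinP (C D E : DM) : (DM_join C D <= E) = (C <= E) && (D <= E).
Proof.
apply/idP/andP; rewrite !DM_leE /=; [move=> h|move=> [h k]].
  by split=> x Ex; apply/h/sub_DM_closure; [left|right].
by rewrite -(DM_setK E); apply: DM_closureS => x [/h|/k].
Qed.

HB.instance Definition _ :=
  Order.POrder_MeetJoin_isLattice.Build d DM DM_meetP DM_joinP.

Lemma DM_complete (F : set DM) : supremums F !=set0 /\ infimums F !=set0.
Proof.
pose U : set L := [set x | exists2 C : DM, F C & DM_set C x].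
pose I : set L := [set x | forall C : DM, F C -> DM_set C x].
have hU : `[< DM_closure U = DM_closure (DM_closure U) >].
  by apply/asboolP; rewrite DM_closure_id.
have hI : `[< I = DM_closure I >].
  apply/asboolP/seteqP; split; first exact: sub_DM_closure.
  by move=> x Ix C FC; rewrite -DM_setK; apply: DM_closureS Ix => y; apply.
split.
  exists (MkDM hU); split=> [C FC|D hD]; rewrite DM_leE /=.
    by move=> x Cx; apply: sub_DM_closure; exists C.
  rewrite -(DM_setK D); apply: DM_closureS => x [C FC Cx].
  by move: (hD C FC); rewrite DM_leE; apply.
exists (MkDM hI); split=> [C FC|D hD]; rewrite DM_leE /=.
  by move=> x; apply.
by move=> x Dx C FC; move: (hD C FC); rewrite DM_leE; apply.
Qed.

End DedekindMacNeille.

(* Main.v *)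
Require Import Defs.
From HB Require Import structures.
From mathcomp Require Import all_boot all_order all_algebra.
From mathcomp Require Import boolp classical_sets reals.
From mathcomp Require Import lra.

(** The lattice consists of the triples [(x, y, z)] with [x != 0], [y != 0],
    [0 < x -> 1 <= z] and [y < 0 -> z <= 0]. Each condition links one
    coordinate to another monotonically (the third has to be high once the
    first is positive, and low as long as the second is negative), so it is
    stable under coordinatewise joins and meets: this is a sublattice of the
    third power of the base field.

    It is regular because removing the hyperplanes [x = 0] and [y = 0] only
    destroys suprema. If [s] is the least upper bound of [A] within the
    sublattice but the coordinatewise supremum has some coordinate strictly
    below that of [s], then this coordinate of [s] can be lowered without
    leaving the sublattice (avoiding 0 by density of the field, and lowering
    the third coordinate as well where a condition requires it) while staying
    above [A], which contradicts the minimality of [s]: see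
    [gated_supremums]. The involution [(x, y, z) |-> (-y, -x, 1 - z)]
    preserves the sublattice and reverses the order, which gives infima. Since
    existing bounds are those of the ambient power of a chain, infinite
    distributivity is inherited from that power.

    In the completion, the removed hyperplanes leave a gap at the origin of
    the first two coordinates, filled by the cut [X] of all triples with
    [x < 0] and [y < 0]. Its members have [z <= 0], whereas its upper bounds
    have [x > 0] and hence [z >= 1]. Consider [p = (-1, 1, 0)] and
    [q = (-1, 1, 1)], which differ only in the third coordinate. An upper
    bound of both [X] and [p] has [x > 0], so [z >= 1], so it is above [q]:
    hence [q] lies below the join of [X] and [p]. A member of [X] below [q]
    has [z <= 0], so it is below [p]: hence [X] and [q] meet below [p]. Thus
    [(X `|` p) `&` q = q] while [(X `&` q) `|` p = p], and the completion is
    not modular. A fortiori it is not distributive, and it cannot embed into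
    a power of a chain, which is distributive. *)

Set Implicit Arguments.
Unset Strict Implicit.
Unset Printing Implicit Defensive.
Import Order.TTheory GRing.Theory Num.Theory.
Local Open Scope classical_set_scope.
Local Open Scope ring_scope.
Local Open Scope order_scope.

(** * Distributive and modular lattices *)

Lemma distributive_modular d (L : latticeType d) : distributive L -> modular L.
Proof. by move=> dL p q x pq; rewrite meetC dL meetC (meet_r pq). Qed.

Lemma lattice_embedding_distributive d d' (X : latticeType d)
    (Y : latticeType d') (f : X -> Y) :
  lattice_embedding f -> distributive Y -> distributive X.
Proof.
by case=> fI fM fU dY x y z; apply: fI; rewrite !(fM, fU) dY.
Qed.

Lemma fun_distributive T d (D : distrLatticeType d) : distributive (T -> D).
Proof. by move=> f g h; apply/funext => i; rewrite !(meetfE, joinfE) meetUr. Qed.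

(** In a chain a value of [x] above [u] can be cancelled from
    [x `&` a <= u], so the upper bound [t] below agrees with [u] at the
    indices where this happens and with [s] elsewhere. *)
Lemma supremums_fun_meet T d (C : orderType d) (A : set (T -> C))
    (s x : T -> C) :
  supremums A s -> supremums [set x `&` a | a in A] (x `&` s).
Proof.
move=> [sub slub]; split=> [_ [a Aa <-]|u ub].
  exact: leI2 (lexx _) (sub a Aa).
pose t i := if x i <= u i then s i else u i.
have /slub /lefP st : ubound A t.
  move=> a Aa; apply/lefP => i; rewrite /t; have [_|uxi] := leP (x i).
    exact: lefP (sub a Aa) i.
  have /lefP/(_ i) := ub (x `&` a) (ex_intro2 _ _ a Aa erefl).
  by rewrite meetfE leIx leNgt uxi.
apply/lefP => i; rewrite meetfE leIx; have := st i; rewrite /t.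
by case: ifP => //= _ ->.
Qed.

(** * Antitone involutions *)

Section AntitoneInvolution.
Context d (T : porderType d) (f : T -> T).
Context (fK : involutive f) (f_anti : {mono f : x y /~ x <= y}).

Let f_antil x y : (f x <= y) = (f y <= x). Proof. by rewrite -f_anti fK. Qed.
Let f_antir x y : (x <= f y) = (y <= f x). Proof. by rewrite -f_anti fK. Qed.

Lemma supremums_anti A s : infimums A s -> supremums (f @` A) (f s).
Proof.
move=> [lbs glbs]; split=> [_ [a Aa <-]|u ub].
  by rewrite f_anti; exact: lbs.
rewrite f_antil; apply: glbs => a Aa; rewrite f_antil.
by apply: ub; exists a.
Qed.

Lemma infimums_anti A s : supremums A s -> infimums (f @` A) (f s).
Proof.
move=> [ubs lubs]; split=> [_ [a Aa <-]|u lb].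
  by rewrite f_anti; exact: ubs.
rewrite f_antir; apply: lubs => a Aa; rewrite f_antir.
by apply: lb; exists a.
Qed.

End AntitoneInvolution.

(** Transports distributivity of meets over suprema to distributivity of joins
    over infima. *)
Lemma meet_anti d (L : latticeType d) (f : L -> L) :
    involutive f -> {mono f : x y /~ x <= y} ->
  forall x y, f (f x `&` f y) = x `|` y.
Proof.
move=> fK fa x y; apply/le_anti/andP; split.
  by rewrite -fa fK lexI !fa leUl leUr.
by rewrite leUx -[x <= _]fa -[y <= _]fa !fK leIl leIr.
Qed.

(** * The sublattice *)

Section Gated.
Context (R : realFieldType).
Implicit Types u v w : 'I_3 -> R.

Definition i0 : 'I_3 := @Ordinal 3 0 isT.
Definition i1 : 'I_3 := @Ordinal 3 1 isT.
Definition i2 : 'I_3 := @Ordinal 3 2 isT.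

Definition vec (a b c : R) : 'I_3 -> R := fun i => nth c [:: a; b] i.

Lemma le3P v w :
  reflect [/\ v i0 <= w i0, v i1 <= w i1 & v i2 <= w i2] (v <= w).
Proof.
apply: (iffP (lefP _ _)) => [//|[h0 h1 h2] [[|[|[|//]]] lti]].
- by rewrite (_ : Ordinal lti = i0) //; exact: val_inj.
- by rewrite (_ : Ordinal lti = i1) //; exact: val_inj.
- by rewrite (_ : Ordinal lti = i2) //; exact: val_inj.
Qed.

Lemma vec_eta v : vec (v i0) (v i1) (v i2) = v.
Proof. by apply/le_anti/andP; split; apply/le3P. Qed.

(** The coordinates [i0] and [i1] act as switches for the coordinate [i2]: a
    positive [i0] forces it to at least 1, a negative [i1] to at most 0. No
    member has both [i0] positive and [i1] negative. *)
Definition gate : pred ('I_3 -> R) := fun v =>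
  [&& v i0 != 0, v i1 != 0,
      (0 < v i0) ==> (1 <= v i2) & (v i1 < 0) ==> (v i2 <= 0)].

Lemma gate_meet : meet_closed gate.
Proof.
move=> v w; rewrite !unfold_in /gate !meetfE !meetEtotal.
by case: (leP (v i0) (w i0)) => ?; case: (leP (v i1) (w i1)) => ?;
  case: (leP (v i2) (w i2)) => ? /and4P[? ? ? ?] /and4P[? ? ? ?];
  apply/and4P; split=> //; lra.
Qed.

Lemma gate_join : join_closed gate.
Proof.
move=> v w; rewrite !unfold_in /gate !joinfE !joinEtotal.
by case: (leP (v i0) (w i0)) => ?; case: (leP (v i1) (w i1)) => ?;
  case: (leP (v i2) (w i2)) => ? /and4P[? ? ? ?] /and4P[? ? ? ?];
  apply/and4P; split=> //; lra.
Qed.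

Record gated := Gated { gated_val :> 'I_3 -> R; gatedP : gate gated_val }.

HB.instance Definition _ := [isSub for gated_val].
HB.instance Definition _ := [Choice of gated by <:].
HB.instance Definition _ := Order.SubChoice_isSubLattice.Build _ ('I_3 -> R)
  gate FunOrder.fun_display gated gate_meet gate_join.

Implicit Types (l m : gated) (A : set gated).

Lemma gated_leE l m : (l <= m) = (gated_val l <= gated_val m).
Proof. exact/esym/Order.le_val. Qed.

Lemma gated_meetE l m : \val (l `&` m) = \val l `&` \val m :> ('I_3 -> R).
Proof. by []. Qed.

(** * An order-reversing symmetry *)

(** The two switches are dual to each other under this map: being positive in
    [i0] and being negative in [i1] are exchanged, together with the
    conditions [1 <= v i2] and [v i2 <= 0] that they impose. *)
Definition flip v := vec (- v i1) (- v i0) (1 - v i2).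

Lemma flipK : involutive flip.
Proof.
by move=> v; rewrite -[RHS]vec_eta /flip /vec /= !opprK opprB addrC subrK.
Qed.

Lemma flip_anti : {mono flip : v w /~ v <= w}.
Proof.
by move=> v w; apply/le3P/le3P => -[]; rewrite /flip /vec /=; split; lra.
Qed.

Lemma gate_flip v : gate v -> gate (flip v).
Proof.
case/and4P=> v0 v1 v02 v12; rewrite /gate /flip /vec /= !oppr_eq0 v0 v1 /=.
by apply/andP; split; lra.
Qed.

Definition gated_flip l : gated := Gated (gate_flip (gatedP l)).

Lemma gated_flipK : involutive gated_flip.
Proof. by move=> l; apply: val_inj; exact: flipK. Qed.

Lemma gated_flip_anti : {mono gated_flip : l m /~ l <= m}.
Proof. by move=> l m; rewrite !gated_leE; exact: flip_anti. Qed.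

(** * Regularity and infinite distributivity *)

(** Lets a switch coordinate be lowered without hitting the forbidden value
    0. *)
Lemma nonzero_between (a b : R) : a < b -> exists c, [/\ c != 0, a <= c & c < b].
Proof.
move=> ab; have [a0|a0] := eqVneq a 0; last by exists a.
by exists (b / 2); split; [rewrite gt_eqF| |]; lra.
Qed.

(** It suffices to bound each coordinate of [s] separately by any bound [r] of
    that coordinate on [A]: were [r] smaller, replacing that coordinate of [s]
    by a value in between would give a smaller upper bound of [A] in the
    sublattice. The replacement might break a switch condition in the
    coordinates [i1] and [i2]; the bounds already obtained for the earlier
    coordinates handle these cases. *)
Lemma gated_supremums A s :
  supremums A s -> supremums [set \val a | a in A] (\val s : 'I_3 -> R).
Proof.
move=> [ubs lubs].
have {}ubs a : A a -> [/\ a i0 <= s i0, a i1 <= s i1 & a i2 <= s i2].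
  by move=> Aa; apply/le3P; rewrite -gated_leE; exact: ubs.
have {}lubs t0 t1 t2 : gate (vec t0 t1 t2) ->
    (forall a, A a -> [/\ a i0 <= t0, a i1 <= t1 & a i2 <= t2]) ->
    [/\ s i0 <= t0, s i1 <= t1 & s i2 <= t2].
  move=> gt ubt; apply: (le3P _ (vec t0 t1 t2)).
  rewrite -[_ <= _]/(s <= Gated gt); apply: lubs => a Aa.
  by rewrite gated_leE; apply/le3P; exact: ubt.
have /and4P[s0 s1 s02 s12] := gatedP s.
have lub0 r : (forall a, A a -> a i0 <= r) -> s i0 <= r.
  move=> ubr; rewrite leNgt; apply/negP => /nonzero_between[c [c0 rc cs]].
  have [||] := lubs c (s i1) (s i2); last by lra.
    by rewrite /gate /vec /= c0 s1 s12 andbT /=; lra.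
  by move=> a Aa; have [? ? ?] := ubs a Aa; have := ubr a Aa; split=> //; lra.
have lub1 r : (forall a, A a -> a i1 <= r) -> s i1 <= r.
  move=> ubr; rewrite leNgt; apply/negP => /nonzero_between[c [c0 rc cs]].
  have [cneg|cpos] := ltP c 0.
    (* The value [c] now forces the coordinate [i2] of the new bound to at most 0.
       This is affordable: [A] is negative in [i1], so its members have
       [i2] at most 0, which in turn keeps them, and then [s], negative
       in [i0]. *)
    have a02 a : A a -> a i0 <= 0 /\ a i2 <= 0.
      move=> Aa; have := ubr a Aa; have /and4P[_ _ a02 a12] := gatedP a.
      by move: a02 a12; split; lra.
    have s0neg : s i0 < 0.
      by rewrite lt_neqAle s0; apply: lub0 => a /a02[].
    have [||] := lubs (s i0) c (Num.min (s i2) 0); last by lra.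
      rewrite /gate /vec /= s0 c0 /= ge_min lexx orbT implybT andbT; lra.
    move=> a Aa; have [? ? ?] := ubs a Aa; have := ubr a Aa.
    by have [? ?] := a02 a Aa; rewrite le_min; split; lra.
  have [||] := lubs (s i0) c (s i2); last by lra.
    by rewrite /gate /vec /= s0 c0 s02 /=; lra.
  by move=> a Aa; have [? ? ?] := ubs a Aa; have := ubr a Aa; split=> //; lra.
have lub2 r : (forall a, A a -> a i2 <= r) -> s i2 <= r.
  move=> ubr; rewrite leNgt; apply/negP => rs.
  have [||] := lubs (s i0) (s i1) r; last by lra.
    rewrite /gate /vec /= s0 s1 /=; apply/andP; split; last by lra.
    (* If [r < 1], then no member of [A] is positive in [i0], so neither
       is [s]. *)
    apply/implyP => s0pos; apply: contraLR s0pos; rewrite -ltNge -leNgt => r1.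
    apply: lub0 => a Aa; have := ubr a Aa; have /and4P[_ _ a02 _] := gatedP a.
    by lra.
  by move=> a Aa; have [? ? ?] := ubs a Aa; have := ubr a Aa; split.
split=> [_ [a Aa <-]|u ubu]; first by apply/le3P; exact: ubs.
have {}ubu a : A a -> [/\ a i0 <= u i0, a i1 <= u i1 & a i2 <= u i2].
  by move=> Aa; apply/le3P/ubu; exists a.
by apply/le3P; split; [apply: lub0|apply: lub1|apply: lub2] => a /ubu[].
Qed.

Lemma gated_infimums A s :
  infimums A s -> infimums [set \val a | a in A] (\val s : 'I_3 -> R).
Proof.
move=> /(supremums_anti gated_flipK gated_flip_anti) /gated_supremums.
move=> /(infimums_anti flipK flip_anti) /=; rewrite flipK.
rewrite !image_comp; congr (infimums _ _).
by apply: eq_imagel => a _ /=; rewrite flipK.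
Qed.

Lemma gated_regular : regular_sublattice gated.
Proof.
by move=> A s _; split; [exact: gated_supremums|exact: gated_infimums].
Qed.

Lemma gated_supremums_meet A s l :
  supremums A s -> supremums [set l `&` a | a in A] (l `&` s).
Proof.
move=> /gated_supremums /(supremums_fun_meet (\val l)) [ubs lubs].
split=> [_ [a Aa <-]|u ubu]; rewrite gated_leE gated_meetE.
  by rewrite gated_meetE; apply: ubs; exists (\val a) => //; exists a.
apply: lubs => _ [_ [a Aa <-] <-]; rewrite -gated_meetE.
by rewrite -[_ <= _]gated_leE; apply: ubu; exists a.
Qed.

Lemma gated_infinitely_distributive : infinitely_distributive gated.
Proof.
split=> A s l; first exact: gated_supremums_meet.
move=> /(supremums_anti gated_flipK gated_flip_anti).
move=> /(gated_supremums_meet (gated_flip l)).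
move=> /(infimums_anti gated_flipK gated_flip_anti).
rewrite (meet_anti gated_flipK gated_flip_anti) !image_comp.
congr (infimums _ _); apply: eq_imagel => a _ /=.
exact: (meet_anti gated_flipK gated_flip_anti).
Qed.

(** * A pentagon in the completion *)

(** The cut that fills the gap left at the origin of the first two
    coordinates. *)
Definition gated_low : set gated := [set l | l i0 < 0 /\ l i1 < 0].

(** The triples [(t0, t1, 1)] with [t0] and [t1] positive are upper bounds of
    [gated_low], and so a triple below all of them has its first two
    coordinates nonpositive, hence negative since 0 is excluded. *)
Lemma gated_low_cut : `[< gated_low = DM_closure gated_low >].
Proof.
apply/asboolP/seteqP; split=> [|l cl]; first exact: sub_DM_closure.
have below t0 t1 : 0 < t0 -> 0 < t1 -> l i0 <= t0 /\ l i1 <= t1.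
  move=> t0p t1p; have gt : gate (vec t0 t1 1).
    by rewrite /gate /vec /= !gt_eqF //=; apply/andP; split; lra.
  suff /cl : ubound gated_low (Gated gt) by rewrite gated_leE => /le3P[].
  move=> m [m0 m1]; rewrite gated_leE; have /and4P[_ _ _ m12] := gatedP m.
  by apply/le3P; rewrite /vec; split=> /=; lra.
have /and4P[l0 l1 _ _] := gatedP l.
split; rewrite lt_neqAle ?l0 ?l1 leNgt; apply/negP => lpos.
  by have [] := below (l i0 / 2) 1; lra.
by have [] := below 1 (l i1 / 2); lra.
Qed.

Lemma principal_cut d (T : porderType d) (x : T) :
  `[< [set y | y <= x] = DM_closure [set y | y <= x] >].
Proof.
apply/asboolP/seteqP; split=> [|y cl]; first exact: sub_DM_closure.
by apply: cl.
Qed.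

Lemma gate_edge_bot : gate (vec (- 1) 1 0).
Proof. by rewrite /gate /vec /= oppr_eq0 oner_eq0; lra. Qed.

Lemma gate_edge_top : gate (vec (- 1) 1 1).
Proof. by rewrite /gate /vec /= oppr_eq0 oner_eq0; lra. Qed.

(** The endpoints of the long side of the pentagon: they agree on both
    switches, with values ([i0] negative, [i1] positive) that leave the
    coordinate [i2] free. *)
Definition edge_bot : gated := Gated gate_edge_bot.
Definition edge_top : gated := Gated gate_edge_top.

Lemma edge_le : edge_bot <= edge_top.
Proof. by rewrite gated_leE; apply/le3P; rewrite /= /vec; split=> /=; lra. Qed.

Lemma edge_lt : ~ edge_top <= edge_bot.
Proof. by rewrite gated_leE => /le3P[_ _]; rewrite /= /vec /=; lra. Qed.

(** An upper bound of [gated_low] is positive in [i0], as [gated_low] contains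
    members arbitrarily close to 0 there, and this switches its [i2] to at
    least 1, the only coordinate where [edge_top] exceeds [edge_bot]. *)
Lemma edge_top_le u :
  gate u -> (forall l, gated_low l -> \val l <= u) -> \val edge_bot <= u ->
  \val edge_top <= u.
Proof.
case/and4P=> u0 _ u02 _ lowu /le3P[]; rewrite /= /vec /= => _ u1 u2.
have u0pos : 0 < u i0.
  rewrite lt_neqAle eq_sym u0 leNgt; apply/negP => u0neg.
  have gl : gate (vec (u i0 / 2) (- 1) 0).
    by rewrite /gate /vec /= oppr_eq0 oner_eq0 lt_eqF /=; lra.
  have /lowu/le3P[] : gated_low (Gated gl).
    by rewrite /gated_low /= /vec /=; split; lra.
  by rewrite /= /vec /=; lra.
by apply/le3P; split=> /=; lra.
Qed.

(** Being negative in [i1], a member of [gated_low] has its [i2] switched to at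
    most 0, so it cannot distinguish [edge_bot] from [edge_top]. *)
Lemma gated_low_edge l : gated_low l -> l <= edge_top -> l <= edge_bot.
Proof.
move=> [l0 l1]; have /and4P[_ _ _ l12] := gatedP l.
rewrite !gated_leE => /le3P[]; rewrite /= /vec /= => *.
by apply/le3P; split=> /=; lra.
Qed.

Lemma gated_DM_not_modular : ~ modular (DM gated).
Proof.
pose P := MkDM (principal_cut edge_bot); pose Q := MkDM (principal_cut edge_top).
pose X := MkDM gated_low_cut.
have PQ : P <= Q by rewrite DM_leE => l lp; exact: le_trans lp edge_le.
move=> /(_ P Q X PQ) modXPQ; apply: edge_lt.
have : DM_set ((X `|` P) `&` Q) edge_top.
  split; last exact: lexx.
  move=> u ubu; rewrite gated_leE; apply: (edge_top_le (gatedP u)) => [l low|].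
    by rewrite -[_ <= _]gated_leE; apply: ubu; left.
  by rewrite -[_ <= _]gated_leE; apply: ubu; right; exact: lexx.
rewrite modXPQ; apply=> l [[low lq]|//].
exact: gated_low_edge low lq.
Qed.

End Gated.

Theorem theorem4p3 (R : realType) :
  exists (S : pred ('I_3 -> R)) (d : Order.disp_t) (L : subLattice S d),
    infinitely_distributive L /\
    regular_sublattice L /\
    ~ modular (DM L) /\
    ~ distributive (DM L) /\
    ~ (exists f : DM L -> ('I_3 -> R), lattice_embedding f).
Proof.
exists (@gate R), FunOrder.fun_display, (gated R : subLattice _ _).
have nmod := @gated_DM_not_modular R.
have ndist : ~ distributive (DM (gated R)) by move=> /distributive_modular.
split; first exact: gated_infinitely_distributive.
split; first exact: gated_regular.
do 2?split => //.
move=> [f ef]; apply: ndist.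
exact: lattice_embedding_distributive ef (@fun_distributive _ _ _).
Qed.
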